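(* For every integer $n\geq 1$, $$\sum_{k=0}^{n-1}(-1)^kq^{-\binom{k+1}{2}}{2k\brack k}_q \equiv \left(\frac{n}{5}\right) q^{-\lfloor n^4/5\rfloor} \pmod{\Phi_n(q)}.$$ In other words, letting $\omega=e^{2\pi m i/n}$, where $m$ is an integer with $\gcd(m,n)=1$, we have $$\sum_{k=0}^{n-1}(-1)^k\omega^{-\binom{k+1}{2}}{2k\brack k}_\omega=\begin{cases}0, &\text{if } n\equiv 0\pmod 5,\\ \omega^{-\lfloor n/5\rfloor}, &\text{if } n\equiv 1\pmod 5,\\ -\omega^{-\lfloor 3n/5\rfloor}, &\text{if } n\equiv 2\pmod 5,\\ -\omega^{-\lfloor 2n/5\rfloor}, &\text{if } n\equiv 3\pmod 5,\\ \omega^{-\lfloor 4n/5\rfloor}, &\text{if } n\equiv 4\pmod 5.\end{cases}$$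
   Context: ${n\brack k}_q$ is the $q$-binomial coefficient, equal to $\frac{(q;q)_n}{(q;q)_k(q;q)_{n-k}}$ if $0\le k\le n$ and $0$ otherwise, where $(z;q)_n=(1-z)(1-zq)\cdots(1-zq^{n-1})$; it is a polynomial in $q$ with integer coefficients, and ${n\brack k}_\omega$ denotes its value at $q=\omega$. $\Phi_n(q)$ is the $n$th cyclotomic polynomial. $\left(\frac{n}{5}\right)$ is the Legendre symbol (equal to $0$ if $5\mid n$). Congruences modulo $\Phi_n(q)$ are between Laurent polynomials, i.e. in the ring $\mathbb{Z}[q,q^{-1}]$. *)

(* Defs.v *)
From mathcomp Require Import all_boot all_order all_algebra all_field.
From mathcomp Require Import complex reals sequences exp trigo.
Set Implicit Arguments.
Unset Strict Implicit.
Unset Printing Implicit Defensive.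
Import Order.TTheory GRing.Theory Num.Theory.
Local Open Scope ring_scope.

Notation "x %:F" := (tofrac x) : ring_scope.

Definition qpoch (A : pzRingType) (z q : A) (n : nat) : A :=
  \prod_(i < n) (1 - z * q ^+ i).

(* The division below is exact, see [qbinomE]: the leading coefficient of the
   divisor is a unit of int, so %/ is Euclidean division in {poly int}. *)
Definition qbinom (n k : nat) : {poly int} :=
  if (k <= n)%N
  then qpoch 'X 'X n %/ (qpoch 'X 'X k * qpoch 'X 'X (n - k))
  else 0.

(* Z[q,q^-1] is taken as a subring of the field of fractions of Z[q]. *)
Definition is_laurent (x : {fraction {poly int}}) : Prop :=
  exists (p : {poly int}) (k : nat), x = p%:F / 'X%:F ^+ k.

Definition laurent_eqmod (M x y : {fraction {poly int}}) : Prop :=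
  exists2 z, is_laurent z & x - y = z * M.

(* The Legendre symbol (a/p), for p an odd prime. *)
Definition legendre (p a : nat) : int :=
  if (p %| a)%N then 0
  else if [exists x : 'I_p, x ^ 2 == a %[mod p]]%N then 1 else -1.

Definition cexp (R : realType) (z : R[i]) : R[i] :=
  (expR (complex.Re z))%:C%C *
  (cos (complex.Im z) +i* sin (complex.Im z))%C.

Definition eval_at (A : nzRingType) (p : {poly int}) (x : A) : A :=
  (map_poly intr p).[x].

Lemma qpochS (A : pzRingType) (z q : A) n :
  qpoch z q n.+1 = qpoch z q n * (1 - z * q ^+ n).
Proof. by rewrite /qpoch big_ord_recr. Qed.

Lemma lead_coef_qpoch n : lead_coef (qpoch 'X 'X n : {poly int}) = (-1) ^+ n.
Proof.
rewrite /qpoch lead_coef_prod (eq_bigr (fun=> -1)) ?prodr_const ?card_ord//.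
move=> i _; rewrite -exprS -opprB lead_coefN.
by rewrite (monicP (monicXnsubC _ _)).
Qed.

Lemma dvd_qpoch (n k : nat) : (k <= n)%N ->
  exists b : {poly int},
    qpoch 'X 'X n = b * (qpoch 'X 'X k * qpoch 'X 'X (n - k)) :> {poly int}.
Proof.
elim: n k => [|n IHn] [|k].
- by move=> _; exists 1; rewrite /qpoch !big_ord0 !mulr1.
- by [].
- by move=> _; exists 1; rewrite subn0 /qpoch big_ord0 !mul1r.
rewrite ltnS leq_eqVlt => /predU1P[->|ltkn].
  by exists 1; rewrite subnn /qpoch big_ord0 mulr1 mul1r.
have [b Eb] := IHn k (ltnW ltkn); have [c Ec] := IHn k.+1 ltkn.
exists (b + 'X^(k.+1) * c).
rewrite mulrDl {1}qpochS subSS.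
have -> : 1 - 'X * 'X^n = (1 - 'X * 'X^k)
    + 'X^(k.+1) * (1 - 'X * 'X^(n - k.+1)) :> {poly int}.
  rewrite -!exprS mulrBr mulr1 -exprD -subSn // addnC subnK; last exact: ltnW.
  by rewrite addrA subrK.
rewrite mulrDr {1}Eb Ec; congr (_ + _).
  by rewrite [in RHS]qpochS -!mulrA; do 2!congr (_ * _); rewrite mulrC.
have -> : (n - k = (n - k.+1).+1)%N by rewrite subnSK.
by rewrite [qpoch _ _ (_ - _).+1]qpochS mulrCA !mulrA.
Qed.

Lemma qbinomE (n k : nat) : (k <= n)%N ->
  qbinom n k * (qpoch 'X 'X k * qpoch 'X 'X (n - k)) = qpoch 'X 'X n.
Proof.
move=> lekn; rewrite /qbinom lekn.
have [b ->] := dvd_qpoch lekn.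
rewrite Pdiv.IdomainUnit.mulpK // lead_coefM !lead_coef_qpoch.
by rewrite unitrM !unitrX // unitrN1.
Qed.

(* Main.v *)
(* At a primitive n-th root of unity x, reversing the factors of a q-binomial
   coefficient through x^n = 1 turns (-1)^k x^-C(k+1,2) [2k,k] into
   x^(k^2) [n-1-k,k], so the sum becomes the Schur polynomial D_(n-1), where
   D_m = D_(m-1) + x^(m-1) D_(m-2). The finite Rogers-Ramanujan identity writes
   D_(n-1) as an alternating sum of binomials [n-1,k], each equal to
   (-1)^k x^-C(k+1,2); the sum then telescopes to four boundary terms, at most
   one of which is nonzero. The congruence modulo Phi_n
   is the vanishing of a polynomial of Z[q] at a complex primitive root. *)

Require Import Defs.
From mathcomp Require Import all_boot all_order all_algebra all_field.
From mathcomp Require Import complex reals sequences exp trigo.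
From mathcomp Require Import ring lra zify.
Import Order.TTheory GRing.Theory Num.Theory.
Local Open Scope ring_scope.

Set Implicit Arguments.
Unset Strict Implicit.

(** * q-binomial coefficients in Z[q]: symmetry and the two Pascal rules *)

Lemma qpoch_neq0 n : qpoch 'X 'X n != 0 :> {poly int}.
Proof. by rewrite -lead_coef_eq0 lead_coef_qpoch signr_eq0. Qed.

Lemma qbinom_small m k : (m < k)%N -> qbinom m k = 0.
Proof. by move=> ltmk; rewrite /qbinom leqNgt ltmk. Qed.

Lemma qbinom_sym m k : (k <= m)%N -> qbinom m (m - k) = qbinom m k.
Proof. by move=> lekm; rewrite /qbinom lekm leq_subr subKn // mulrC. Qed.

Lemma qbinom0 m : qbinom m 0 = 1.
Proof.
apply: (mulIf (qpoch_neq0 m)).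
by have := qbinomE (leq0n m); rewrite subn0 {1}/qpoch big_ord0 !mul1r.
Qed.

Lemma qbinomn m : qbinom m m = 1.
Proof. by rewrite -(qbinom_sym (leqnn m)) subnn qbinom0. Qed.

(** Once the nonzero q-factorials are cleared, the case k < m is 1 - q^(m+1) = (1 - q^(m-k)) +
    q^(m-k) (1 - q^(k+1)). *)
Lemma qbinomS m k :
  qbinom m.+1 k.+1 = qbinom m k.+1 + 'X^(m - k) * qbinom m k.
Proof.
have [ltmk|ltkm|->] := ltngtP m k.
- by rewrite !qbinom_small ?mulr0 ?addr0 //; exact: leqW.
- apply: (mulIf (mulf_neq0 (qpoch_neq0 k.+1) (qpoch_neq0 (m - k)))).
  have := qbinomE (ltnW ltkm); have := qbinomE ltkm.
  have /(_ (ltnW ltkm)) := @qbinomE m.+1 k.+1; rewrite subSS => ->.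
  have -> : (m - k = (m - k.+1).+1)%N by rewrite subnSK.
  rewrite !qpochS; set d := (m - k.+1)%N => E1 E2.
  have -> : 'X^m = 'X^(d.+1) * 'X^k :> {poly int}.
    by rewrite -exprD; congr (_ ^+ _); rewrite /d; lia.
  have -> (b c p r s t u : {poly int}) :
      (b + u * c) * (p * r * (s * t)) =
      b * (p * r * s) * t + u * (c * (p * (s * t))) * r by ring.
  by rewrite E1 E2 exprS; move: ('X^d) ('X^k) => u v; ring.
- by rewrite subnn mul1r !qbinomn qbinom_small ?add0r.
Qed.

(** Follows from [qbinomS] by symmetry. The induction in [schur_identity] plays the two rules
    against each other. *)
Lemma qbinomSl m k :
  qbinom m.+1 k.+1 = 'X^(k.+1) * qbinom m k.+1 + qbinom m k.
Proof.
have [ltmk|ltkm|->] := ltngtP m k.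
- by rewrite !qbinom_small ?mulr0 ?addr0 //; exact: leqW.
- rewrite -(@qbinom_sym m.+1) 1?ltnW // subSS -(subnSK ltkm) qbinomS addrC.
  by rewrite qbinom_sym // subnSK // qbinom_sym 1?ltnW // subKn.
- by rewrite qbinomS subnn mul1r qbinom_small ?mulr0.
Qed.

(** * Evaluated q-binomial coefficients *)

Section Evaluation.
Context {F : fieldType}.
Implicit Types x : F.

Local Notation B x m k := (eval_at (qbinom m k) x).

Lemma evalB0 x m : B x m 0 = 1.
Proof. by rewrite qbinom0 /eval_at rmorph1 hornerC. Qed.

Lemma evalBn x m : B x m m = 1.
Proof. by rewrite qbinomn /eval_at rmorph1 hornerC. Qed.

Lemma evalB_small x m k : (m < k)%N -> B x m k = 0.
Proof. by move=> ?; rewrite qbinom_small // /eval_at rmorph0 horner0. Qed.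

Lemma evalBS x m k :
  B x m.+1 k.+1 = B x m k.+1 + x ^+ (m - k) * B x m k.
Proof.
by rewrite qbinomS /eval_at rmorphD rmorphM /= map_polyXn hornerD hornerM hornerXn.
Qed.

Lemma evalBSl x m k :
  B x m.+1 k.+1 = x ^+ k.+1 * B x m k.+1 + B x m k.
Proof.
by rewrite qbinomSl /eval_at rmorphD rmorphM /= map_polyXn hornerD hornerM hornerXn.
Qed.

Lemma evalBE x m k : (k <= m)%N ->
  B x m k * (qpoch x x k * qpoch x x (m - k)) = qpoch x x m.
Proof.
have P j : qpoch x x j = eval_at (qpoch 'X 'X j) x.
  rewrite /eval_at /qpoch rmorph_prod horner_prod; apply: eq_bigr => i _.
  by rewrite rmorphB rmorphM rmorphXn /= rmorph1 map_polyX !hornerE.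
by move=> /qbinomE E; rewrite !P -E /eval_at !rmorphM /= !hornerM.
Qed.

(** The Pascal rule transposed onto the weights, so that descending a row becomes a computation on
    [f] alone. *)
Lemma sum_evalBS x m (f : nat -> F) :
  \sum_(k < m.+2) f k * B x m.+1 k =
  \sum_(k < m.+1) (f k + x ^+ (m - k) * f k.+1) * B x m k.
Proof.
rewrite big_ord_recl /= evalB0.
under eq_bigr => i _ do rewrite evalBS mulrDr.
under [RHS]eq_bigr => i _ do rewrite mulrDl.
rewrite !big_split /= addrA; congr (_ + _); last first.
  by apply: eq_bigr => i _; rewrite mulrCA mulrA.
by rewrite big_ord_recr /= evalB_small // mulr0 addr0 [RHS]big_ord_recl evalB0.
Qed.

Lemma sum_evalBSl x m (f : nat -> F) :
  \sum_(k < m.+2) f k * B x m.+1 k =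
  \sum_(k < m.+1) (x ^+ k * f k + f k.+1) * B x m k.
Proof.
rewrite big_ord_recl /= evalB0.
under eq_bigr => i _ do rewrite evalBSl mulrDr.
under [RHS]eq_bigr => i _ do rewrite mulrDl.
rewrite !big_split /= addrA; congr (_ + _).
rewrite big_ord_recr /= evalB_small // !mulr0 addr0 [RHS]big_ord_recl evalB0 mul1r.
by congr (_ + _); apply: eq_bigr => i _; rewrite mulrCA mulrA.
Qed.

(** Finite form of the Rogers-Ramanujan series with terms q^(k^2)/(q;q)_k; terms with 2k > m
    vanish. *)
Definition schur_poly x m := \sum_(k < m.+1) x ^+ (k ^ 2) * B x (m - k) k.

(** Pascal's rule splits each term k >= 1; since k^2 + (m + 2 - 2k) = (k-1)^2 + (m+1), the second
    part is x^(m+1) times term k-1 of [schur_poly x m]. *)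
Lemma schur_polySS x m :
  schur_poly x m.+2 = schur_poly x m.+1 + x ^+ m.+1 * schur_poly x m.
Proof.
rewrite /schur_poly big_ord_recr /= subnn evalB_small // mulr0 addr0.
rewrite big_ord_recl [in RHS]big_ord_recl /= !evalB0 -addrA; congr (_ + _).
rewrite mulr_sumr -big_split; apply: eq_bigr => i _ /=; rewrite /bump add1n subSS.
have lei : (i <= m)%N by rewrite -ltnS.
rewrite subSn //.
rewrite evalBS mulrDr; congr (_ + _).
(* The exponent m - i - i is a truncated subtraction, correct only for 2i <= m; beyond that the
   binomial is zero. *)
have [lt2i|le2i] := ltnP (m - i) i; first by rewrite evalB_small // !mulr0.
rewrite !mulrA -!exprD; congr (_ ^+ _ * _).
by rewrite /= !expnS; nia.
Qed.

(** * The finite Rogers-Ramanujan identity *)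

Section SchurIdentity.
Context (x : F).
Hypothesis x0 : x != 0.

(** General term of the theta series on the product side of the first Rogers-Ramanujan identity;
    j(5j+1) is always even, so the division is exact. *)
Definition schur_coef (j : int) : F := (-1) ^ j * x ^ (j * (5 * j + 1) %/ 2)%Z.

(* With [d = m - 2k], the coefficient of [B m k] in Schur's identity is
   [schur_wt d + schur_wt (d - 1)]: it is supported on d = 0, 1 mod 5. *)
Definition schur_wt (d : int) : F :=
  if (5 %| d)%Z then schur_coef (d %/ 5)%Z else 0.

Lemma schur_wt5 j : schur_wt (5 * j) = schur_coef j.
Proof. by rewrite /schur_wt dvdz_mulr // mulKz. Qed.

Lemma schur_wtN5 d : ~~ (5 %| d)%Z -> schur_wt d = 0.
Proof. by rewrite /schur_wt => /negbTE ->. Qed.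

(** For d = 5j, passing from j to j+1 flips the sign and raises the exponent by 5j+3 = d+3. *)
Lemma schur_wtD5 d : schur_wt (d + 5) = - x ^ (d + 3) * schur_wt d.
Proof.
have [/dvdzP[j ->]|N5] := boolP (5 %| d)%Z; last first.
  by rewrite !schur_wtN5 ?mulr0 //; lia.
rewrite [j * 5]mulrC -{2}[5]mulr1 -mulrDr !schur_wt5 /schur_coef.
rewrite expfzDr ?oppr_eq0 ?oner_eq0 // expr1z mulrN1 !mulNr mulrCA -expfzDr //.
do 3!congr (_ _); rewrite -(@divzMDl (5 * j + 3) _ 2) //; congr (_ %/ _)%Z; ring.
Qed.

(** Both sides satisfy the recurrence of [schur_polySS] and agree for m = 0 and m = 1. *)
Lemma schur_identity m :
  schur_poly x m = \sum_(k < m.+1)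
    (schur_wt (m%:Z - 2 * k%:Z) + schur_wt (m%:Z - 2 * k%:Z - 1)) * B x m k.
Proof.
pose G m := \sum_(k < m.+1)
    (schur_wt (m%:Z - 2 * k%:Z) + schur_wt (m%:Z - 2 * k%:Z - 1)) * B x m k.
have G_SS i : G i.+2 = G i.+1 + x ^+ i.+1 * G i.
  rewrite {1}/G; under eq_bigr => k _ do rewrite mulrDl.
  rewrite big_split /=.
  (* Using a different Pascal rule for each family leaves one term of each free of powers of x;
     these two make up [G i.+1], and [f], [g] are the leftovers. *)
  rewrite (sum_evalBSl x i.+1 (fun k => schur_wt (i.+2%:Z - 2 * k%:Z))).
  rewrite (sum_evalBS x i.+1 (fun k => schur_wt (i.+2%:Z - 2 * k%:Z - 1))).
  pose f k := x ^+ k * schur_wt (i.+2%:Z - 2 * k%:Z).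
  pose g k := x ^+ (i.+1 - k) * schur_wt (i%:Z - 2 * k%:Z - 1).
  transitivity (G i.+1 + (\sum_(k < i.+2) f k * B x i.+1 k
                        + \sum_(k < i.+2) g k * B x i.+1 k)).
    rewrite /G -!big_split; apply: eq_bigr => k _ /=; rewrite -!mulrDl.
    congr (_ * _); rewrite /f /g.
    have -> : i.+2%:Z - 2 * k.+1%:Z = i%:Z - 2 * k%:Z by lia.
    have -> : i.+1%:Z - 2 * k%:Z - 1 = i%:Z - 2 * k%:Z by lia.
    have -> : i.+2%:Z - 2 * k%:Z - 1 = i.+1%:Z - 2 * k%:Z by lia.
    by ring.
  (* The rules are now exchanged. With d = i - 2k, the terms x^k W(d+2) and x^(i-k) W(d-3), where W
     is [schur_wt], cancel by [schur_wtD5]; the other two carry x^(i+1). *)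
  congr (_ + _); rewrite sum_evalBS sum_evalBSl -big_split mulr_sumr.
  apply: eq_bigr => k _ /=; rewrite -mulrDl mulrA; congr (_ * _).
  have lek : (k <= i)%N by rewrite -ltnS.
  rewrite /f /g subSS !mulrA -!exprD mulrDr.
  have -> : (i - k + k.+1 = i.+1)%N by lia.
  have -> : (k + (i.+1 - k) = i.+1)%N by lia.
  have -> : i.+2%:Z - 2 * k.+1%:Z = i%:Z - 2 * k%:Z by lia.
  have -> : i%:Z - 2 * k.+1%:Z - 1 = i%:Z - 2 * k%:Z - 3 by lia.
  have -> : i.+2%:Z - 2 * k%:Z = i%:Z - 2 * k%:Z - 3 + 5 by lia.
  rewrite schur_wtD5 mulrA mulrN [x ^+ k]exprnP -expfzDr //.
  have -> : k%:Z + (i%:Z - 2 * k%:Z - 3 + 3) = (i - k)%N%:Z by lia.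
  by rewrite -exprnP; ring.
suff [] : schur_poly x m = G m /\ schur_poly x m.+1 = G m.+1 by [].
elim: m => [|m [IH1 IH2]]; last by split; rewrite ?schur_polySS ?G_SS ?IH1 ?IH2.
(* The base cases only meet the indices 1, 0, -1, -2, and only 0 is a multiple of 5. *)
have wt0 : schur_wt 0 = 1 by rewrite (schur_wt5 0) /schur_coef mul0r div0z !expr0z mul1r.
rewrite /schur_poly /G !big_ord_recl !big_ord0 /= !evalB0 !evalBn /bump /= add1n.
rewrite evalB_small // !(mulr0, subr0, wt0) !(@schur_wtN5 1, @schur_wtN5 (1 - 2)) //.
rewrite !(@schur_wtN5 (0 - 1), @schur_wtN5 (1 - 2 - 1)) //.
by split; ring.
Qed.

End SchurIdentity.

(** * Specialization at a root of unity *)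

Lemma qpochD x a k :
  qpoch x x (a + k) = qpoch x x a * \prod_(i < k) (1 - x ^+ (a + i).+1).
Proof.
elim: k => [|k IHk]; first by rewrite addn0 big_ord0 mulr1.
by rewrite addnS qpochS IHk big_ord_recr /= mulrA -exprS.
Qed.

Lemma qpoch_rev x a k : (k <= a)%N ->
  qpoch x x a = qpoch x x (a - k) * \prod_(i < k) (1 - x ^+ (a - i)).
Proof.
elim: k => [|k IHk] ltka; first by rewrite subn0 big_ord0 mulr1.
rewrite IHk 1?ltnW // -{1}(subnSK ltka) qpochS big_ord_recr /=.
by rewrite -exprS subnSK // -mulrA; congr (_ * _); rewrite mulrC.
Qed.

Section RootOfUnity.
Context (x : F) (n : nat).
Hypothesis prim_x : n.-primitive_root x.

Lemma primitive_root_neq0 : x != 0.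
Proof.
have n0 := prim_order_gt0 prim_x; apply/eqP => x0; move: (prim_expr_order prim_x).
by rewrite x0 expr0n gtn_eqF // => /eqP; rewrite eq_sym oner_eq0.
Qed.
Hint Resolve primitive_root_neq0 : core.

Lemma qpoch_root_neq0 j : (j < n)%N -> qpoch x x j != 0.
Proof.
move=> ltjn; apply/prodf_neq0 => i _; rewrite subr_eq0 -exprS eq_sym.
rewrite -(prim_order_dvd prim_x) gtnNdvd //.
by apply: leq_ltn_trans ltjn; exact: ltn_ord.
Qed.

Lemma qpoch_root_eq0 j : (n <= j)%N -> qpoch x x j = 0.
Proof.
have n0 := prim_order_gt0 prim_x; move=> lenj.
have ltnj : (n.-1 < j)%N by rewrite prednK.
rewrite /qpoch (bigD1 (Ordinal ltnj)) //= -exprS prednK //.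
by rewrite (prim_expr_order prim_x) subrr mul0r.
Qed.

(** As x^n = 1, multiplying 1 - x^(n-1-j-i) by x^(j+i+1) gives -(1 - x^(j+i+1)); the exponents j+i+1
    for i < k add up to jk + C(k+1,2). The bound on j + k keeps the denominators nonzero. *)
Lemma evalB_reflect j k : (j + k < n)%N ->
  B x (n.-1 - j) k * x ^+ (j * k + 'C(k.+1, 2)) = (-1) ^+ k * B x (j + k) k.
Proof.
move=> ltn; apply: (mulIf (qpoch_root_neq0 (leq_ltn_trans (leq_addl j k) ltn))).
have le1 : (k <= n.-1 - j)%N by lia.
have lt1 : (n.-1 - j - k < n)%N by lia.
have -> : (-1) ^+ k * B x (j + k) k * qpoch x x k
        = (-1) ^+ k * \prod_(i < k) (1 - x ^+ (j + i).+1).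
  apply: (mulIf (qpoch_root_neq0 (leq_ltn_trans (leq_addr k j) ltn))).
  have := evalBE x (leq_addl j k); rewrite addnK -!mulrA => ->; rewrite qpochD.
  by rewrite [qpoch x x j * _]mulrC.
have -> : B x (n.-1 - j) k * x ^+ (j * k + 'C(k.+1, 2)) * qpoch x x k
        = \prod_(i < k) (1 - x ^+ (n.-1 - j - i)) * x ^+ (j * k + 'C(k.+1, 2)).
  apply: (mulIf (qpoch_root_neq0 lt1)).
  rewrite [RHS]mulrAC [\prod_(i < k) _ * _]mulrC -(qpoch_rev x le1) -(evalBE x le1).
  by ring.
elim: k ltn {le1 lt1} => [|k IHk] ltn; first by rewrite muln0 !big_ord0.
rewrite !big_ord_recr /= binS bin1 mulnS.
have -> : (j + j * k + ('C(k.+1, 2) + k.+1) = j * k + 'C(k.+1, 2) + (j + k).+1)%N by lia.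
rewrite exprD mulrACA IHk; last by lia.
rewrite [in RHS]exprS mulrBl mul1r -exprD.
have -> : (n.-1 - j - k + (j + k).+1 = n)%N by lia.
by rewrite (prim_expr_order prim_x); ring.
Qed.

(** The sums agree term by term: [evalB_reflect] with j = k settles 2k < n, and for 2k >= n both
    terms are zero, on the left because (x;x)_(2k) vanishes while (x;x)_k does not. *)
Lemma central_sum_schur :
  \sum_(k < n) (-1) ^+ k * x ^ (- ('C(k.+1, 2))%:Z) * B x (2 * k) k =
  schur_poly x n.-1.
Proof.
have n0 := prim_order_gt0 prim_x.
rewrite /schur_poly prednK //; apply: eq_bigr => k _.
have [lt2k|le2k] := ltnP (2 * k) n.
  have := @evalB_reflect k k; rewrite addnn -mul2n => /(_ lt2k) E.
  by rewrite mulrAC -E mulnn -mulrA exprnP -expfzDr // PoszD addrK -exprnP mulrC.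
rewrite [B x (n.-1 - k) k]evalB_small ?mulr0; last by lia.
suff -> : B x (2 * k) k = 0 by rewrite mulr0.
have := @evalBE x (2 * k) k; rewrite (qpoch_root_eq0 le2k) => /(_ ltac:(lia))/eqP.
have -> : (2 * k - k = k)%N by lia.
by rewrite !mulf_eq0 (negbTE (qpoch_root_neq0 (ltn_ord k))) !orbF => /eqP.
Qed.

(* Encodes x^(n/2) = -1 for even n in a form that needs no case on parity. *)
Lemma root_half (u t : int) : 2 * u = n%:Z * t -> x ^ u = (-1) ^ t.
Proof.
have sgn2 (s : int) : (-1 : F) ^ (2 * s) = 1.
  by rewrite -exprz_exp -exprnP sqrrN expr1n exp1rz.
have [N2|N2] := boolP (odd n); move=> ut.
  (* For odd n, t must be even and u a multiple of n, so both sides are 1. *)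
  have n1 : n%:Z = 1 + 2 * n./2%:Z by lia.
  have t2 : t = 2 * (u - n./2%:Z * t) by rewrite mulrBr ut n1; ring.
  have -> : u = n%:Z * (u - n./2%:Z * t).
    by apply: (@mulfI _ 2) => //; rewrite ut {1}t2 mulrCA.
  rewrite {2}t2.
  by rewrite -exprz_exp -exprnP (prim_expr_order prim_x) exp1rz sgn2.
have n2 : n = n./2.*2 by rewrite even_halfK.
have n0 := prim_order_gt0 prim_x.
have xh : x ^+ n./2 = -1.
  have /eqP := prim_expr_order prim_x; rewrite {1}n2 -muln2 exprM sqrf_eq1.
  rewrite -(prim_order_dvd prim_x) gtnNdvd /=; [by move/eqP|lia|lia].
by rewrite -xh exprnP exprz_exp; congr (x ^ _); lia.
Qed.

Local Notation W := (schur_wt x).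

(** By [evalB_reflect] with j = 0, row n-1 consists of the values [s k]; the sum in [schur_identity]
    then telescopes with step two. *)
Lemma schur_poly_root :
  schur_poly x n.-1 =
  W (n%:Z - 2) - x^-1 * W (n%:Z - 4) + W (- n%:Z - 2) - x^-1 * W (- n%:Z - 4).
Proof.
have n0 := prim_order_gt0 prim_x.
pose s k : F := (-1) ^+ k * x ^ (- ('C(k.+1, 2))%:Z).
pose T k := W (n%:Z - 2 - 2 * k%:Z) * s k.
have sS k : s k.+1 = - s k * x ^ (- k.+1%:Z).
  by rewrite /s binS bin1 exprS mulN1r PoszD opprD expfzDr // !mulNr mulrA.
transitivity (\sum_(k < n) (T k - T k.+2)).
  rewrite schur_identity // prednK //; apply: eq_bigr => k _.
  have -> : B x n.-1 k = s k.
    have := @evalB_reflect 0 k; rewrite subn0 mul0n add0n evalBn => /(_ (ltn_ord k)).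
    by rewrite mulr1 /s => <-; rewrite exprnP -mulrA -expfzDr // subrr expr0z mulr1.
  rewrite /T mulrDl addrC; congr (_ * _ + _); first by congr W; lia.
  (* The other weight yields -T(k+2): the exponent from [schur_wtD5] is n - (k+1) - (k+2), where n
     drops out and the rest turns [s k] into [s k.+2]. *)
  have -> : n.-1%:Z - 2 * k%:Z = n%:Z - 2 - 2 * k.+2%:Z + 5 by lia.
  rewrite schur_wtD5 // !sS !mulNr opprK -!mulrA; congr (- _).
  rewrite mulrCA; congr (_ * _); rewrite mulrC -mulrA -!expfzDr //.
  have -> : n%:Z - 2 - 2 * k.+2%:Z + 3 = n%:Z + (- k.+1%:Z + - k.+2%:Z) by lia.
  by rewrite addrCA [x ^ (n%:Z + _)]expfzDr // -exprnP (prim_expr_order prim_x) mul1r.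
have -> : \sum_(k < n) (T k - T k.+2) = T 0 + T 1 - T n - T n.+1.
  elim: n => [|m IHm]; first by rewrite big_ord0; ring.
  by rewrite big_ord_recr /= IHm; ring.
(* Since 2 C(n+1,2) = n(n+1), [root_half] turns the power of x into the sign (-1)^(-(n+1)), whatever
   the parity of n. *)
have sn : s n = -1.
  have C2 : (2 * 'C(n.+1, 2) = n * n.+1)%N by rewrite -mul_bin_diag bin1 mulnC.
  rewrite /s (@root_half _ (- n.+1%:Z)) 1?exprnP; last by lia.
  rewrite -expfzDr ?oppr_eq0 ?oner_eq0 //.
  by rewrite -addn1 PoszD opprD addrA subrr add0r exprN1 invrN1.
have s0 : s 0 = 1 by rewrite /s mul1r.
have s1 : s 1 = - x^-1 by rewrite sS s0 mulN1r exprN1.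
have sn1 : s n.+1 = x^-1.
  rewrite sS sn opprK mul1r -addn1 PoszD opprD expfzDr // -exprnN.
  by rewrite (prim_expr_order prim_x) invr1 mul1r exprN1.
rewrite /T s0 s1 sn sn1.
have -> : n%:Z - 2 - 2 * 0%:Z = n%:Z - 2 by lia.
have -> : n%:Z - 2 - 2 * 1%:Z = n%:Z - 4 by lia.
have -> : n%:Z - 2 - 2 * n%:Z = - n%:Z - 2 by lia.
have -> : n%:Z - 2 - 2 * n.+1%:Z = - n%:Z - 4 by lia.
by ring.
Qed.

Definition root_value : F :=
  if (n %% 5 == 0)%N then 0
  else if (n %% 5 == 1)%N then x ^ (- (n %/ 5)%N%:Z)
  else if (n %% 5 == 2)%N then - x ^ (- ((3 * n) %/ 5)%N%:Z)
  else if (n %% 5 == 3)%N then - x ^ (- ((2 * n) %/ 5)%N%:Z)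
  else x ^ (- ((4 * n) %/ 5)%N%:Z).

(** The exponent j(5j+1)/2 is b + nt/2, and the half multiple of n contributes (-1)^t by
    [root_half]; [m] witnesses that j + t is odd, hence the minus sign. *)
Lemma schur_coef_root (j b t m : int) :
  2 * b + n%:Z * t = j * (5 * j + 1) -> j + t = 1 + 2 * m ->
  schur_coef x j = - x ^ b.
Proof.
move=> jb jt; have [a ja] : exists a, j * (5 * j + 1) = 2 * a.
  have [i [->|->]] : exists i, j = 2 * i \/ j = 2 * i + 1.
  - by exists (j %/ 2)%Z; lia.
  - by exists (i * (5 * (2 * i) + 1)); ring.
  - by exists ((2 * i + 1) * (5 * i + 3)); ring.
have N1 : (-1 : F) != 0 by rewrite oppr_eq0 oner_eq0.
have xu : x ^ (a - b) = (-1) ^ t by apply: root_half; rewrite mulrBr -ja -jb; ring.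
rewrite /schur_coef ja mulKz // -(subrK b a) expfzDr // xu mulrA -expfzDr // jt.
by rewrite expfzDr // expr1z -exprz_exp -exprnP sqrrN expr1n exp1rz mulr1 mulN1r.
Qed.

(** Among n-2, n-4, -n-2, -n-4, a multiple of 5 occurs exactly when n is 2, 4, 3, 1 mod 5
    respectively, so at most one boundary term survives. *)
Lemma schur_poly_root_value : schur_poly x n.-1 = root_value.
Proof.
rewrite schur_poly_root /root_value.
have [q Eq] : exists q, n = (5 * q + n %% 5)%N by exists (n %/ 5)%N; lia.
have := ltn_mod n 5; case: (n %% 5)%N Eq => [|[|[|[|[|]]]]] // Eq _ /=.
- by rewrite !schur_wtN5; [ring|lia..].
- have -> : - n%:Z - 4 = 5 * - (q%:Z + 1) by lia.
  rewrite (@schur_wtN5 _ (n%:Z - 2)) 1?(@schur_wtN5 _ (n%:Z - 4)); try lia.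
  rewrite (@schur_wtN5 _ (- n%:Z - 2)); last by lia.
  (* With j = -(q+1), j(5j+1) = (q+1)(5q+4) = 2(1-q) + n(q+2). The later cases divide by n likewise,
     with a quotient of parity opposite to j. *)
  rewrite schur_wt5 (@schur_coef_root _ (1 - q%:Z) (q%:Z + 2) 0); [|nia|lia].
  have -> : (n %/ 5 = q)%N by lia.
  have -> : x ^ (- q%:Z) = x^-1 * x ^ (1 - q%:Z).
    by rewrite -[x^-1]exprN1 -expfzDr // addKr.
  by ring.
- have -> : n%:Z - 2 = 5 * q%:Z by lia.
  rewrite !(@schur_wtN5 _ (_ - _)); try lia.
  rewrite schur_wt5 (@schur_coef_root _ (- (3 * q%:Z + 1)) (q%:Z + 1) q); [|nia|lia].
  have -> : (3 * n %/ 5 = 3 * q + 1)%N by lia.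
  by rewrite PoszD PoszM; ring.
- have -> : - n%:Z - 2 = 5 * - (q%:Z + 1) by lia.
  rewrite !(@schur_wtN5 _ (_ - _)); try lia.
  rewrite schur_wt5 (@schur_coef_root _ (- (2 * q%:Z + 1)) (q%:Z + 2) 0); [|nia|lia].
  have -> : (2 * n %/ 5 = 2 * q + 1)%N by lia.
  by rewrite PoszD PoszM; ring.
- have -> : n%:Z - 4 = 5 * q%:Z by lia.
  rewrite !(@schur_wtN5 _ (_ - _)); try lia.
  rewrite schur_wt5 (@schur_coef_root _ (- (4 * q%:Z + 2)) (q%:Z + 1) q); [|nia|lia].
  have -> : (4 * n %/ 5 = 4 * q + 3)%N by lia.
  have -> : - (4 * q + 3)%N%:Z = - 1 - (4 * q%:Z + 2) by lia.
  by rewrite [in RHS]expfzDr // exprN1; ring.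
Qed.

End RootOfUnity.
End Evaluation.

(** * Reduction modulo a cyclotomic polynomial *)

Lemma legendre5E n : legendre 5 n =
  if (n %% 5 == 0)%N then 0
  else if (n %% 5 == 1)%N || (n %% 5 == 4)%N then 1 else -1.
Proof.
rewrite /legendre /dvdn; have := ltn_mod n 5; case: eqP => // /eqP.
case: (n %% 5)%N => [|[|[|[|[|]]]]] // _ _ /=.
- by case: existsP => // -[]; exists 1.
- by case: existsP => // -[[[|[|[|[|[|]]]]] ?]].
- by case: existsP => // -[[[|[|[|[|[|]]]]] ?]].
- by case: existsP => // -[]; exists (@Ordinal 5 2 isT).
Qed.

(** If n^3 = 5a + s with s < 5, then floor(n^4/5) = an + floor(sn/5), and x^(an) = 1. The cubes of
    1, 2, 3, 4 mod 5 are 1, 3, 2, 4, the multipliers in [root_value]. *)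
Lemma root_value_legendre (F : fieldType) (x : F) n : n.-primitive_root x ->
  root_value x n = (legendre 5 n)%:~R * x ^ (- (n ^ 4 %/ 5)%N%:Z).
Proof.
move=> prim_x; have x0 := primitive_root_neq0 prim_x.
have E s : (n ^ 3 = s %[mod 5])%N -> (s < 5)%N ->
    x ^ (- (n ^ 4 %/ 5)%N%:Z) = x ^ (- (s * n %/ 5)%N%:Z).
  move=> ns lts; rewrite expnS (divn_eq (n ^ 3) 5) ns (modn_small lts).
  rewrite mulnDr mulnA divnMDl // PoszD opprD expfzDr // [(n * s)%N]mulnC -[RHS]mul1r.
  by congr (_ * _); rewrite -exprnN exprM (prim_expr_order prim_x) expr1n invr1.
rewrite legendre5E /root_value.
have n3 : (n ^ 3 = (n %% 5) ^ 3 %[mod 5])%N by rewrite modnXm.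
have := ltn_mod n 5; move: n3; case: (n %% 5)%N => [|[|[|[|[|]]]]] // n3 _ /=.
- by rewrite mul0r.
- by rewrite (E 1) // mul1n mul1r.
- by rewrite (E 3) // mulN1r.
- by rewrite (E 2) // mulN1r.
- by rewrite (E 4) // mul1r.
Qed.

(** Division by the monic ['Phi_n] stays in Z[q]. The remainder vanishes at z, whose minimal
    polynomial over Q is ['Phi_n], so its degree forces it to be 0. *)
Lemma Cyclotomic_dvd n (z : algC) (p : {poly int}) :
  n.-primitive_root z -> eval_at p z = 0 -> exists q, p = q * 'Phi_n.
Proof.
move=> prim_z pz; pose r := Pdiv.Ring.rmodp p 'Phi_n.
have Ep := Pdiv.RingMonic.rdivp_eq (Cyclotomic_monic n) p.
suff r0 : r = 0 by exists (Pdiv.Ring.rdivp p 'Phi_n); rewrite {1}Ep -/r r0 addr0.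
have rz : root (map_poly intr r) z.
  have := pz; rewrite /eval_at Ep rmorphD rmorphM /= hornerD hornerM.
  rewrite (Cintr_Cyclotomic prim_z).
  have /eqP -> : root (cyclotomic z n) z by rewrite root_cyclotomic.
  by rewrite mulr0 add0r => /eqP.
have [m [Em mon_m dvd_m]] := minCpolyP z.
have : root (map_poly ratr (map_poly intr r : {poly rat})) z.
  by rewrite -map_poly_comp (eq_map_poly (fun i => ratr_int _ i)).
rewrite dvd_m => dv; apply/eqP; apply: contraT => r_n0.
have szr : size (map_poly intr r : {poly rat}) = size r.
  by rewrite size_map_poly_id0 // intr_eq0 lead_coef_eq0.
have := dvdp_leq _ dv; rewrite -size_poly_eq0 szr size_poly_eq0 => /(_ r_n0).
rewrite -(size_map_poly (ratr : {rmorphism rat -> algC})) /= -Em.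
rewrite (minCpoly_cyclotomic prim_z) -(Cintr_Cyclotomic prim_z).
have -> : size (map_poly intr 'Phi_n : {poly algC}) = size 'Phi_n.
  by rewrite size_map_poly_id0 // intr_eq0 lead_coef_eq0 monic_neq0 // Cyclotomic_monic.
by rewrite leqNgt Pdiv.Ring.ltn_rmodpN0 // monic_neq0 // Cyclotomic_monic.
Qed.

Lemma exprB_expz (K : fieldType) (y : K) a b : y != 0 -> (b <= a)%N ->
  y ^+ (a - b) = y ^+ a * y ^ (- b%:Z).
Proof. by move=> y0 leba; rewrite -exprnN exprB ?unitfE. Qed.

Lemma eq_divM (K : fieldType) (y d a b : K) : y != 0 -> y * d = a * b -> d = a / y * b.
Proof. by move=> y0 ydab; apply: (mulfI y0); rewrite mulrA mulrCA divff // mulr1. Qed.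

Lemma central_sum_laurent n : (0 < n)%N ->
  laurent_eqmod ('Phi_n)%:F
    (\sum_(k < n) (-1) ^+ k * 'X%:F ^ (- ('C(k.+1, 2))%:Z)
                  * (qbinom (2 * k) k)%:F)
    ((legendre 5 n)%:~R * 'X%:F ^ (- (n ^ 4 %/ 5)%N%:Z)).
Proof.
move=> n0; have [z prim_z] := C_prim_root_exists n0.
have z0 := primitive_root_neq0 prim_z.
(* Multiplying by X^K clears every negative power on both sides, so the congruence becomes
   divisibility of [p] in Z[X]. *)
pose K := ('C(n.+1, 2) + n ^ 4 %/ 5)%N.
have leK (k : 'I_n) : ('C(k.+1, 2) <= K)%N.
  by apply: leq_trans (leq_addr _ _); rewrite leq_bin2l // ltnS ltnW.
pose p : {poly int} :=
  \sum_(k < n) (-1) ^+ k * 'X^(K - 'C(k.+1, 2)) * qbinom (2 * k) k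
  - (legendre 5 n)%:~R * 'X^(K - n ^ 4 %/ 5).
have pz : eval_at p z = 0.
  pose ev : {rmorphism {poly int} -> algC} := horner_eval z \o map_poly intr.
  have evX : ev 'X = z by rewrite /ev /= /horner_eval map_polyX hornerX.
  rewrite -[LHS]/(ev p) rmorphB rmorph_sum rmorphM rmorph_int rmorphXn evX.
  under eq_bigr => k _.
    rewrite !rmorphM !rmorphXn rmorphN1 evX exprB_expz // [_ * (z ^+ K * _)]mulrCA.
    rewrite -[X in _ * X]/(eval_at (qbinom (2 * k) k) z) -mulrA; over.
  rewrite -mulr_sumr central_sum_schur // schur_poly_root_value //.
  by rewrite root_value_legendre // exprB_expz ?leq_addl // mulrCA subrr.
have [q Eq] := Cyclotomic_dvd prim_z pz.
have X0 : 'X%:F != 0 :> {fraction {poly int}} by rewrite tofrac_eq0 polyX_eq0.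
exists (q%:F / 'X%:F ^+ K); first by exists q, K.
apply: (eq_divM (expf_neq0 K X0)).
transitivity p%:F; last first.
  rewrite -(tofracM q 'Phi_n).
  by rewrite Eq.
rewrite tofracB tofracM rmorph_sum rmorph_int tofracXn exprB_expz ?leq_addl //.
rewrite mulrBr mulr_sumr mulrCA; congr (_ - _); apply: eq_bigr => k _.
rewrite !rmorphM rmorph_sign rmorphXn /= exprB_expz //.
by rewrite !mulrA; congr (_ * _ * _); rewrite mulrC.
Qed.

Lemma coprimez_prim_root (F : fieldType) (z : F) n (m : int) :
  n.-primitive_root z -> coprimez m n%:Z -> n.-primitive_root (z ^ m).
Proof.
move=> prim_z cop; have n0 : n%:Z != 0 by rewrite -lt0n (prim_order_gt0 prim_z).
have z0 := primitive_root_neq0 prim_z.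
have := modz_ge0 m n0; case Ek : (m %% n%:Z)%Z => [k|//] _.
have -> : z ^ m = z ^+ k.
  rewrite (divz_eq m n%:Z) Ek expfzDr // [(m %/ _)%Z * _]mulrC -exprz_exp -exprnP.
  by rewrite (prim_expr_order prim_z) exp1rz mul1r.
by rewrite prim_root_exp_coprime // /coprime -[gcdn k n]/(absz (gcdz k n)) -Ek gcdz_modl.
Qed.

(** * Complex roots of unity *)

Section ComplexExponential.
Context {R : realType}.
Implicit Types (t : R) (n : nat).
Local Notation cis t := (@cexp R (0 +i* t)%C).

Lemma cisE t : cis t = (cos t +i* sin t)%C.
Proof. by rewrite /cexp /= expR0 mul1r. Qed.

Lemma cisD t u : cis (t + u) = cis t * cis u.
Proof.
rewrite !cisE cosD sinD; apply/eqP; rewrite eq_complex /=.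
by rewrite eqxx /= addrC [cos t * _]mulrC [sin t * cos u]mulrC; apply/eqP; ring.
Qed.

Lemma cisMn t k : cis (t *+ k) = cis t ^+ k.
Proof.
elim: k => [|k IHk]; first by rewrite mulr0n cisE cos0 sin0 expr0.
by rewrite mulrS cisD IHk exprS.
Qed.

Lemma cisN t : cis (- t) = (cis t)^-1.
Proof.
have e : cis (- t) * cis t = 1 by rewrite -cisD addNr cisE cos0 sin0.
have t0 : cis t != 0 by apply: contra_eq_neq e => ->; rewrite mulr0 eq_sym oner_neq0.
by rewrite -[LHS]mulr1 -(divff t0) mulrA e mul1r.
Qed.

Lemma cisMz t (m : int) : cis (t * m%:~R) = cis t ^ m.
Proof.
case: m => m; first by rewrite mulr_natr cisMn.
by rewrite NegzE -exprnN -cisMn mulrNz mulrN cisN -mulr_natr.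
Qed.

Lemma cis_prim_root n : (0 < n)%N -> n.-primitive_root (cis (2 * pi / n%:R)).
Proof.
move=> n0; have nR : (n%:R : R) != 0 by rewrite pnatr_eq0 -lt0n.
have zn : cis (2 * pi / n%:R) ^+ n = 1.
  have E : 2 * pi / n%:R *+ n = pi *+ 2 :> R.
    by rewrite -[LHS]mulr_natr divfK // mulr_natl.
  by rewrite -cisMn E cisE cos2pi sin2pi.
have [d prim_d dvd] := prim_order_exists n0 zn.
have d0 := prim_order_gt0 prim_d.
suff led : (n <= d)%N.
  by rewrite [X in X.-primitive_root _](_ : n = d) //; apply/eqP; rewrite eqn_leq led dvdn_leq.
rewrite leqNgt; apply/negP => ltdn.
have := prim_expr_order prim_d; rewrite -cisMn cisE => -[+ _].
(* An order d < n puts the half angle [y] strictly between 0 and pi, where sin y > 0, but cos(2y) =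
   1 forces sin y = 0. *)
pose y : R := pi * d%:R / n%:R.
have -> : 2 * pi / n%:R *+ d = y *+ 2 by rewrite -[LHS]mulr_natr -[RHS]mulr_natr /y; ring.
rewrite cos_mulr2n => cos1.
have : 0 < sin y.
  apply: sin_gt0_pi; rewrite /y divr_gt0 ?mulr_gt0 ?pi_gt0 ?ltr0n //=.
  by rewrite ltr_pdivrMr ?ltr0n // ltr_pM2l ?pi_gt0 // ltr_nat.
rewrite lt0r => /andP[+ _]; rewrite -sqrf_eq0 sin2cos2; apply/negP; rewrite negbK.
by apply/eqP; lra.
Qed.

End ComplexExponential.

Unset Implicit Arguments.

Theorem theorem2p1 (n : nat) (hn : (0 < n)%N) :
  laurent_eqmod ('Phi_n)%:F
    (\sum_(k < n) (-1) ^+ k * 'X%:F ^ (- ('C(k.+1, 2))%:Z)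
                  * (qbinom (2 * k) k)%:F)
    ((legendre 5 n)%:~R * 'X%:F ^ (- (n ^ 4 %/ 5)%N%:Z))
  /\
  forall (R : realType) (m : int), coprimez m n%:Z ->
    let w : R[i] := cexp (0 +i* (2 * pi * m%:~R / n%:R))%C in
    let S : R[i] := \sum_(k < n) (-1) ^+ k * w ^ (- ('C(k.+1, 2))%:Z)
                                 * eval_at (qbinom (2 * k) k) w in
    [/\ n = 0 %[mod 5] -> S = 0,
        n = 1 %[mod 5] -> S = w ^ (- (n %/ 5)%N%:Z),
        n = 2 %[mod 5] -> S = - w ^ (- ((3 * n) %/ 5)%N%:Z),
        n = 3 %[mod 5] -> S = - w ^ (- ((2 * n) %/ 5)%N%:Z)
      & n = 4 %[mod 5] -> S = w ^ (- ((4 * n) %/ 5)%N%:Z)].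
Proof.
split=> [|R m cop w S]; first exact: central_sum_laurent.
have prim_w : n.-primitive_root w.
  rewrite /w mulrAC cisMz; exact: coprimez_prim_root (cis_prim_root hn) cop.
have {S} -> : S = root_value w n.
  by rewrite /S central_sum_schur // schur_poly_root_value.
by rewrite /root_value; split=> ->.
Qed.
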